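(* Let $\mathbb{M}=(M_p)_{p\in\mathbb{N}_0}$ be a weight sequence with $\omega(\mathbb{M})\in(0,\infty)$. Then $\omega(\mathbb{M})\notin\widetilde{I}_{\mathbb{M}}$; that is, the asymptotic Borel map $\widetilde{\mathcal{B}}:\widetilde{\mathcal{A}}_{\mathbb{M}}(S_{\omega(\mathbb{M})})\to\mathbb{C}[[z]]_{\mathbb{M}}$ is not injective.
   Context: Sequences. $\mathbb{N}_0=\{0,1,2,\dots\}$. A weight sequence is a sequence $\mathbb{M}=(M_p)_{p\in\mathbb{N}_0}$ of positive reals with $M_0=1$, logarithmically convex ($M_p^2\le M_{p-1}M_{p+1}$ for $p\ge1$), whose sequence of quotients $m_p:=M_{p+1}/M_p$ tends to $\infty$. Its index is $\omega(\mathbb{M}):=\liminf_{p\to\infty}\frac{\log m_p}{\log p}\in[0,\infty]$. Sectors. $\mathcal{R}$ is the Riemann surface of the logarithm. For $\gamma>0$, $S_\gamma=\{z\in\mathcal{R}:|\arg z|<\gamma\pi/2\}$ (unbounded). A bounded sector $T$, i.e. $T=\{z\in\mathcal{R}:|\arg z-d|<\alpha\pi/2,\ |z|<r\}$ with $d\in\mathbb{R}$, $\alpha,r>0$, is a proper (bounded) subsector of $S_\gamma$, written $T\ll S_\gamma$, if its closure in $\mathcal{R}$ (so the vertex $0$ is not considered) is contained in $S_\gamma$. Classes. $\widetilde{\mathcal{A}}_{\mathbb{M}}(S_\gamma)$ is the space of holomorphic $f:S_\gamma\to\mathbb{C}$ admitting an $\mathbb{M}$-asymptotic expansion: there is a formal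 power series $\widehat f=\sum_{p\ge0}a_pz^p$ such that for every $T\ll S_\gamma$ there are $C_T,A_T>0$ with $|f(z)-\sum_{n=0}^{p-1}a_nz^n|\le C_TA_T^pM_p|z|^p$ for all $z\in T$, $p\in\mathbb{N}_0$. The series $\widehat f$ is unique. $\mathbb{C}[[z]]_{\mathbb{M}}$ is the set of $\sum a_pz^p\in\mathbb{C}[[z]]$ for which there is $A>0$ with $\sup_p|a_p|/(A^pM_p)<\infty$. The asymptotic Borel map is $\widetilde{\mathcal{B}}(f)=\widehat f$. $\widetilde{I}_{\mathbb{M}}$ is the set of $\gamma>0$ such that $\widetilde{\mathcal{B}}:\widetilde{\mathcal{A}}_{\mathbb{M}}(S_\gamma)\to\mathbb{C}[[z]]_{\mathbb{M}}$ is injective. *)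

(* Defs.v *)
From Stdlib Require Import Reals Lra Lia ClassicalEpsilon FunctionalExtensionality.
From Coquelicot Require Import Coquelicot.
Open Scope R_scope.

Definition quotient (M : nat -> R) (p : nat) : R := M (S p) / M p.

Record weight_sequence (M : nat -> R) : Prop := {
  ws_pos : forall p, 0 < M p;
  ws_zero : M 0%nat = 1;
  ws_logconvex : forall p, M (S p) ^ 2 <= M p * M (S (S p));
  ws_quotient : is_lim_seq (quotient M) p_infty
}.

(** The junk values of the sequence at [p = 0, 1] (where [ln p = 0]) do not
    affect the lower limit. *)
Definition omega (M : nat -> R) : Rbar :=
  LimInf_seq (fun p => ln (quotient M p) / ln (INR p)).

(** A point is given by its modulus and its argument (the second component,
    which is not taken modulo [2 * PI]).  Pairs whose first component is not
    positive are not points of the surface; every sector below excludes them. *)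
Definition surface : UniformSpace :=
  prod_UniformSpace R_UniformSpace R_UniformSpace.

Definition modulus (z : surface) : R := fst z.
Definition arg (z : surface) : R := snd z.
Definition on_surface (z : surface) : Prop := 0 < modulus z.

Definition proj (z : surface) : C :=
  (modulus z * cos (arg z), modulus z * sin (arg z)).

Definition sector (gamma : R) (z : surface) : Prop :=
  on_surface z /\ Rabs (arg z) < gamma * PI / 2.

Definition bounded_sector (d alpha r : R) (z : surface) : Prop :=
  on_surface z /\ Rabs (arg z - d) < alpha * PI / 2 /\ modulus z < r.

Definition surface_closure (T : surface -> Prop) (z : surface) : Prop :=
  on_surface z /\ forall P, locally z P -> exists y, P y /\ T y.

Definition proper_subsector (T : surface -> Prop) (gamma : R) : Prop :=
  (exists d alpha r : R, 0 < alpha /\ 0 < r /\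
     forall z, T z <-> bounded_sector d alpha r z) /\
  (forall z, surface_closure T z -> sector gamma z).

(** Complex differentiability in the local coordinate [proj], which is
    injective near every point of the surface; [U] is meant to be open. *)
Definition holomorphic_on (U : surface -> Prop) (f : surface -> C) : Prop :=
  forall z0, U z0 -> exists l : C,
    filterlim (fun z : surface => ((f z - f z0) / (proj z - proj z0))%C)
      (locally' z0) (locally l).

(** A formal power series is the sequence of its coefficients. *)
Definition partial_sum (a : nat -> C) (p : nat) (w : C) : C :=
  match p with
  | O => 0%C
  | S q => sum_n (fun n => (a n * w ^ n)%C) q
  end.

Definition asymptotic_expansion (M : nat -> R) (gamma : R)
    (f : surface -> C) (a : nat -> C) : Prop :=
  forall T, proper_subsector T gamma ->
    exists CT AT : R, 0 < CT /\ 0 < AT /\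
      forall z, T z -> forall p : nat,
        Cmod (f z - partial_sum a p (proj z))%C
          <= CT * AT ^ p * M p * modulus z ^ p.

(** Only the values of [f] on the sector matter. *)
Definition class_A (M : nat -> R) (gamma : R) (f : surface -> C) : Prop :=
  holomorphic_on (sector gamma) f /\
  exists a, asymptotic_expansion M gamma f a.

Definition class_series (M : nat -> R) (a : nat -> C) : Prop :=
  exists A : R, 0 < A /\ exists K : R, forall p,
    Cmod (a p) / (A ^ p * M p) <= K.

(** The asymptotic expansion of [f]; see [borel_map_eq]. *)
Definition borel_map (M : nat -> R) (gamma : R) (f : surface -> C) : nat -> C :=
  epsilon (inhabits (fun _ : nat => RtoC 0)) (asymptotic_expansion M gamma f).

(** Elements of the class are functions on the sector, so they are compared
    there. *)
Definition borel_injective (M : nat -> R) (gamma : R) : Prop :=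
  forall f g, class_A M gamma f -> class_A M gamma g ->
    borel_map M gamma f = borel_map M gamma g ->
    forall z, sector gamma z -> f z = g z.

Definition I_tilde (M : nat -> R) (gamma : R) : Prop :=
  0 < gamma /\ borel_injective M gamma.

Lemma half_sector_proper (gamma : R) : 0 < gamma ->
  proper_subsector (bounded_sector 0 (gamma / 2) 1) gamma.
Proof.
intros hg; split.
- exists 0, (gamma / 2), 1; split; [lra|split; [lra|reflexivity]].
- intros z [hz hcl]; split; [exact hz|].
  destruct (Rlt_or_le (Rabs (arg z)) (gamma * PI / 2)) as [h|h]; [exact h|].
  assert (he : 0 < gamma * PI / 4).
  { pose proof PI_RGT_0; pose proof (Rmult_lt_0_compat _ _ hg PI_RGT_0); lra. }
  destruct (hcl (ball z (mkposreal _ he)) (locally_ball z _))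
    as [y [[_ hy] [_ [hT _]]]].
  exfalso.
  change (Rabs (arg y - arg z) < gamma * PI / 4) in hy.
  revert hT hy h; unfold Rabs; repeat destruct Rcase_abs; intros; lra.
Qed.

Lemma partial_sum_S (a : nat -> C) (p : nat) (w : C) :
  partial_sum a (S p) w = (partial_sum a p w + a p * w ^ p)%C.
Proof.
destruct p as [|p]; cbn [partial_sum].
- rewrite sum_O; simpl; ring.
- rewrite sum_Sn; reflexivity.
Qed.

Lemma le_of_perturb (x y K : R) :
  (forall r, 0 < r < 1 -> x <= y + K * r) -> x <= y.
Proof.
intros h; destruct (Rle_or_lt x y) as [hxy|hxy]; [exact hxy|].
set (B := Rabs K + (x - y) + 1).
assert (hK := Rle_abs K); assert (hK0 := Rabs_pos K).
assert (hB : 0 < B) by (unfold B; lra).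
assert (hr : 0 < (x - y) / B < 1).
{ split; [apply Rdiv_lt_0_compat; lra|].
  apply Rmult_lt_reg_r with B; [lra|].
  unfold Rdiv; rewrite Rmult_assoc, Rinv_l by lra; unfold B; lra. }
specialize (h _ hr).
assert (e : (x - y) / B * B = x - y) by (field; lra).
assert (K * ((x - y) / B) <= Rabs K * ((x - y) / B))
  by (apply Rmult_le_compat_r; lra).
assert ((x - y) / B * B = (x - y) / B * Rabs K + (x - y) / B * (x - y + 1))
  by (unfold B; ring).
assert (0 < (x - y) / B * (x - y + 1)) by (apply Rmult_lt_0_compat; lra).
lra.
Qed.

Lemma proj_real (r : R) : proj (r, 0) = RtoC r.
Proof.
unfold proj, modulus, arg, RtoC; cbn [fst snd]; rewrite cos_0, sin_0; f_equal; ring.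
Qed.

Lemma half_sector_real (gamma r : R) : 0 < gamma -> 0 < r < 1 ->
  bounded_sector 0 (gamma / 2) 1 (r, 0).
Proof.
intros hg hr; unfold bounded_sector, on_surface, modulus, arg; cbn [fst snd].
replace (0 - 0) with 0 by ring; rewrite Rabs_R0.
pose proof (Rmult_lt_0_compat _ _ hg PI_RGT_0); lra.
Qed.

Lemma asymptotic_expansion_unique M gamma f a b : 0 < gamma ->
  asymptotic_expansion M gamma f a -> asymptotic_expansion M gamma f b -> a = b.
Proof.
intros hg ha hb.
destruct (ha _ (half_sector_proper gamma hg)) as [C1 [A1 [_ [_ h1]]]].
destruct (hb _ (half_sector_proper gamma hg)) as [C2 [A2 [_ [_ h2]]]].
assert (hsum : forall p, (forall w, partial_sum a p w = partial_sum b p w) ->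
   a p = b p).
{ intros p hp.
  set (K := C1 * A1 ^ S p * M (S p) + C2 * A2 ^ S p * M (S p)).
  assert (hz : Cmod (a p - b p)%C <= 0).
  { apply (le_of_perturb _ _ K); intros r hr.
    assert (hz := half_sector_real gamma r hg hr).
    specialize (h1 _ hz (S p)); specialize (h2 _ hz (S p)).
    rewrite proj_real, partial_sum_S in h1, h2.
    change (modulus (r, 0)) with r in h1, h2.
    rewrite hp in h1.
    set (u := (f (r, 0) - _)%C) in h1; set (v := (f (r, 0) - _)%C) in h2.
    assert (hrp : 0 < r ^ p) by (apply pow_lt; lra).
    apply Rmult_le_reg_r with (r ^ p); [exact hrp|].
    assert (e : Cmod (a p - b p)%C * r ^ p = Cmod (v - u)%C).
    { replace (v - u)%C with ((a p - b p) * RtoC r ^ p)%C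
        by (unfold u, v; ring).
      rewrite Cmod_mult, Cmod_pow, Cmod_R, Rabs_pos_eq by lra; reflexivity. }
    rewrite e; unfold Cminus; eapply Rle_trans; [apply Cmod_triangle|].
    rewrite Cmod_opp; unfold K; simpl pow in *; lra. }
  assert (hc : (a p - b p)%C = 0%C)
    by (apply Cmod_eq_0; pose proof (Cmod_ge_0 (a p - b p)%C); lra).
  replace (a p) with (a p - b p + b p)%C by ring; rewrite hc; ring. }
assert (hps : forall p w, partial_sum a p w = partial_sum b p w).
{ induction p as [|p IH]; intros w; [reflexivity|].
  rewrite !partial_sum_S, IH, (hsum p IH); reflexivity. }
apply functional_extensionality; intros p; apply hsum, hps.
Qed.

Lemma borel_map_spec M gamma f : class_A M gamma f ->
  asymptotic_expansion M gamma f (borel_map M gamma f).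
Proof. intros [_ h]; unfold borel_map; apply epsilon_spec, h. Qed.

Lemma borel_map_eq M gamma f a : 0 < gamma ->
  asymptotic_expansion M gamma f a -> borel_map M gamma f = a.
Proof.
intros hg ha; apply (asymptotic_expansion_unique M gamma f); auto.
unfold borel_map; apply epsilon_spec; exists a; exact ha.
Qed.

Lemma borel_map_class M gamma f : 0 < gamma -> weight_sequence M ->
  class_A M gamma f -> class_series M (borel_map M gamma f).
Proof.
intros hg hM hf; assert (ha := borel_map_spec M gamma f hf).
set (a := borel_map M gamma f) in *.
destruct (ha _ (half_sector_proper gamma hg)) as [C1 [A1 [hC [hA h1]]]].
exists A1; split; [exact hA|]; exists C1; intros p.
assert (hMp := ws_pos M hM p); assert (hAp := pow_lt _ p hA).
assert (hAM := Rmult_lt_0_compat _ _ hAp hMp).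
apply Rle_div_l; [exact hAM|].
apply (le_of_perturb _ _ (C1 * A1 ^ S p * M (S p))); intros r hr.
assert (hz := half_sector_real gamma r hg hr).
assert (h2 := h1 _ hz (S p)); specialize (h1 _ hz p).
rewrite proj_real in h1, h2; rewrite partial_sum_S in h2.
change (modulus (r, 0)) with r in h1, h2.
set (u := (f (r, 0) - _)%C) in h1; set (v := (f (r, 0) - _)%C) in h2.
assert (hrp : 0 < r ^ p) by (apply pow_lt; lra).
apply Rmult_le_reg_r with (r ^ p); [exact hrp|].
assert (e : Cmod (a p) * r ^ p = Cmod (u - v)%C).
{ replace (u - v)%C with (a p * RtoC r ^ p)%C by (unfold u, v; ring).
  rewrite Cmod_mult, Cmod_pow, Cmod_R, Rabs_pos_eq by lra; reflexivity. }
rewrite e; unfold Cminus; eapply Rle_trans; [apply Cmod_triangle|].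
rewrite Cmod_opp; simpl pow in *; lra.
Qed.

(* Main.v *)
(** Write [w] for the index and [rho = 1 / w].  The lower limit defining [w] gives
    [m_p >= c_n (p + 1) ^ (1 / (rho + e_n))] for every [e_n > 0], hence
    [- ln (M_p t ^ p) <= K_n t ^ (- rho - e_n)] for all [p] and [t > 0].  Choosing
    [a_n = 2 ^ (- n - 1) / K_n] and [e_n -> 0], the infimum over [n] of these bounds is
    at most [t ^ (- rho) / H t], where [H z = sum_n a_n z ^ e_n].  For small [e_n], [H]
    has no zero on the sector; as [z -> 0] the terms with small exponents dominate, so
    [arg (H z) -> 0], and the real part of [z ^ (- rho) / H z] is comparable with
    [|z| ^ (- rho) / H |z|] on proper subsectors.  Hence [exp (- z ^ (- rho) / H z)] is a
    nowhere vanishing function with zero expansion. *)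

Require Import Defs.
From Stdlib Require Import Reals Lra Lia ClassicalEpsilon.
From Coquelicot Require Import Coquelicot.
Open Scope R_scope.

(** * Complex differentiability *)

Lemma Cmod_sqr (z : C) : Cmod z ^ 2 = Re z ^ 2 + Im z ^ 2.
Proof. unfold Cmod, Re, Im; apply pow2_sqrt; nra. Qed.

Lemma Cmod_le_Re_Im (z : C) : Cmod z <= Rabs (Re z) + Rabs (Im z).
Proof.
assert (h1 := Rabs_pos (Re z)); assert (h2 := Rabs_pos (Im z)).
assert (h := Cmod_sqr z); rewrite <- (pow2_abs (Re z)), <- (pow2_abs (Im z)) in h.
apply Rnot_lt_le; intros hl; nra.
Qed.

Lemma im_le_Cmod (z : C) : Rabs (Im z) <= Cmod z.
Proof. eapply Rle_trans; [apply Rmax_r|apply Rmax_Cmod]. Qed.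

Definition cexp (z : C) : C := (exp (Re z) * cos (Im z), exp (Re z) * sin (Im z)).

Lemma cexp_plus (z w : C) : cexp (z + w) = (cexp z * cexp w)%C.
Proof.
unfold cexp, Re, Im; apply injective_projections; simpl;
  rewrite exp_plus, ?cos_plus, ?sin_plus; ring.
Qed.

Lemma Cmod_cexp (z : C) : Cmod (cexp z) = exp (Re z).
Proof.
assert (hp := exp_pos (Re z)).
unfold cexp, Cmod; simpl fst; simpl snd.
transitivity (sqrt (exp (Re z) ^ 2)); [f_equal|apply sqrt_pow2; lra].
assert (h := sin2_cos2 (Im z)); unfold Rsqr in h.
transitivity (exp (Re z) ^ 2 * (sin (Im z) * sin (Im z) + cos (Im z) * cos (Im z)));
  [|rewrite h]; ring.
Qed.

Lemma cexp_neq_0 (z : C) : cexp z <> 0%C.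
Proof. apply Cmod_gt_0; rewrite Cmod_cexp; apply exp_pos. Qed.

(** Since [1 - x <= exp (- x)], one has [exp x * (1 - x) <= 1]; the remainder is then at most
    [x ^ 2 / (1 - x)], and [1 - x >= / 2]. *)
Lemma exp_taylor1 (x : R) : Rabs x <= / 2 -> Rabs (exp x - 1 - x) <= 2 * x ^ 2.
Proof.
intros hx; apply Rabs_le_between in hx.
assert (h1 := exp_ineq1_le x); assert (h2 := exp_ineq1_le (- x)).
assert (h3 : exp x * exp (- x) = 1) by (rewrite <- exp_plus, Rplus_opp_r; apply exp_0).
assert (hp := exp_pos x).
rewrite Rabs_pos_eq by lra.
assert (exp x * (1 - x) <= 1) by nra.
apply Rmult_le_reg_r with (1 - x); nra.
Qed.

Lemma sin_taylor1 (y : R) : Rabs y <= / 2 -> Rabs (sin y - y) <= y ^ 2.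
Proof.
assert (H : forall y, 0 <= y <= / 2 -> y - y ^ 2 <= sin y <= y).
{ clear; intros y hy; split.
  (* Order [0] of the alternating bounds reads [y - y ^ 3 / 6 <= sin y]. *)
  - destruct (pre_sin_bound y 0) as [h _]; try lra.
    unfold sin_approx, sin_term in h; simpl in h; nra.
  - destruct (Req_dec y 0) as [->|h]; [rewrite sin_0; lra|].
    apply Rlt_le, sin_lt_x; lra. }
intros hy; apply Rabs_le_between in hy; apply Rabs_le_between.
destruct (Rle_or_lt 0 y) as [h|h].
- specialize (H y); nra.
- specialize (H (- y)); rewrite sin_neg in H; nra.
Qed.

Lemma Rabs_sin_le (y : R) : Rabs (sin y) <= Rabs y.
Proof.
assert (H : forall t, 0 <= t -> Rabs (sin t) <= t).
{ intros t [ht| <-]; [|rewrite sin_0, Rabs_R0; lra].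
  assert (h := SIN_bound t); assert (h1 := sin_lt_x t ht).
  apply Rabs_le_between; split; [|lra].
  destruct (Rle_or_lt 1 t); [lra|].
  assert (0 <= sin t) by (apply sin_ge_0; assert (h2 := PI2_1); lra); lra. }
destruct (Rle_or_lt 0 y) as [h|h].
- rewrite (Rabs_pos_eq y h); apply H, h.
- rewrite <- (Rabs_Ropp y), <- Rabs_Ropp, <- sin_neg, (Rabs_pos_eq (- y)) by lra.
  apply H; lra.
Qed.

Lemma cos_taylor1 (y : R) : 1 - y ^ 2 / 2 <= cos y.
Proof.
replace y with (2 * (y / 2)) at 2 by lra; rewrite cos_2a_sin.
assert (h := pow_incr _ _ 2 (conj (Rabs_pos _) (Rabs_sin_le (y / 2)))).
rewrite !pow2_abs in h; lra.
Qed.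

Lemma cexp_taylor1 (h : C) : Cmod h <= / 2 ->
  Cmod (cexp h - 1 - h)%C <= 5 * Cmod h ^ 2.
Proof.
intros hh; rewrite Cmod_sqr.
assert (hx := Rle_trans _ _ _ (re_le_Cmod h) hh).
assert (hy := Rle_trans _ _ _ (im_le_Cmod h) hh).
destruct h as [x y]; unfold Re, Im in hx, hy; simpl in hx, hy.
assert (e1 := exp_taylor1 x hx); assert (e2 := sin_taylor1 y hy).
assert (e3 := cos_taylor1 y).
apply Rabs_le_between in hx; apply Rabs_le_between in hy.
apply Rabs_le_between in e1; apply Rabs_le_between in e2.
assert (hc := COS_bound y); assert (hs := SIN_bound y).
eapply Rle_trans; [apply Cmod_le_Re_Im|].
unfold cexp; simpl.
(* The grouping isolates the remainders of [exp x], [cos y] and [sin y]; the only other term,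
   [x * y], is at most [(x ^ 2 + y ^ 2) / 2] in absolute value. *)
replace (exp x * cos y + - (1) + - x)
  with ((exp x - 1 - x) * cos y + (1 + x) * (cos y - 1)) by ring.
replace (exp x * sin y + - 0 + - y)
  with ((exp x - 1 - x) * sin y + (1 + x) * (sin y - y) + x * y) by ring.
set (a := exp x - 1 - x) in *; set (c := cos y) in *; set (s := sin y) in *.
assert (hm : forall u v U V, - U <= u <= U -> - V <= v <= V -> - (U * V) <= u * v <= U * V).
{ intros u v U V hu hv; apply Rabs_le_between.
  rewrite Rabs_mult; apply Rmult_le_compat; try apply Rabs_pos; apply Rabs_le_between; lra. }
assert (h1 := hm a c _ 1 e1 ltac:(lra)).
assert (h2 := hm a s _ 1 e1 ltac:(lra)).
assert (h3 := hm (1 + x) (c - 1) (3 / 2) (y ^ 2 / 2) ltac:(lra) ltac:(lra)).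
assert (h4 := hm (1 + x) (s - y) (3 / 2) (y ^ 2) ltac:(lra) ltac:(lra)).
assert (- ((x ^ 2 + y ^ 2) / 2) <= x * y <= (x ^ 2 + y ^ 2) / 2)
  by (assert (q1 := pow2_ge_0 (x + y)); assert (q2 := pow2_ge_0 (x - y)); split; lra).
assert (hA : Rabs (a * c + (1 + x) * (c - 1)) <= 2 * x ^ 2 + y ^ 2)
  by (apply Rabs_le_between; assert (q1 := pow2_ge_0 x); assert (q2 := pow2_ge_0 y); lra).
assert (hB : Rabs (a * s + (1 + x) * (s - y) + x * y) <= 5 / 2 * x ^ 2 + 2 * y ^ 2)
  by (apply Rabs_le_between; assert (q1 := pow2_ge_0 x); assert (q2 := pow2_ge_0 y); lra).
nra.
Qed.

(* Complex differentiability with a quadratic remainder: it needs no filters, is stable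
   under composition, and passes to series by comparison. *)
Definition quad_diff (F : C -> C) (s l : C) : Prop :=
  exists K d : R, 0 <= K /\ 0 < d /\ forall h, Cmod h <= d ->
    Cmod (F (s + h) - F s - l * h)%C <= K * Cmod h ^ 2.

Lemma quad_diff_lin (c s : C) : quad_diff (fun z => c * z)%C s c.
Proof.
exists 0, 1; split; [lra|split; [lra|intros h _]].
replace (c * (s + h) - c * s - c * h)%C with (RtoC 0) by ring.
rewrite Cmod_0; lra.
Qed.

Lemma quad_diff_cexp (s : C) : quad_diff cexp s (cexp s).
Proof.
exists (exp (Re s) * 5), (/ 2).
assert (hp := exp_pos (Re s)).
split; [lra|split; [lra|intros h hh]].
replace (cexp (s + h) - cexp s - cexp s * h)%C with (cexp s * (cexp h - 1 - h))%C
  by (rewrite cexp_plus; ring).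
rewrite Cmod_mult, Cmod_cexp, Rmult_assoc.
apply Rmult_le_compat_l; [lra|apply cexp_taylor1, hh].
Qed.

Lemma quad_diff_lipschitz (F : C -> C) (s l : C) : quad_diff F s l ->
  exists L d : R, 0 <= L /\ 0 < d /\ forall h, Cmod h <= d ->
    Cmod (F (s + h) - F s)%C <= L * Cmod h.
Proof.
intros (K & d & hK & hd & H).
(* For [Cmod h <= 1] the quadratic remainder is at most [K * Cmod h]. *)
exists (Cmod l + K), (Rmin d 1).
assert (hl := Cmod_ge_0 l).
split; [lra|split; [apply Rmin_glb_lt; lra|intros h hh]].
assert (h1 := Rle_trans _ _ _ hh (Rmin_l _ _)).
assert (h2 := Rle_trans _ _ _ hh (Rmin_r _ _)).
replace (F (s + h) - F s)%C with ((F (s + h) - F s - l * h) + l * h)%C by ring.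
eapply Rle_trans; [apply Cmod_triangle|].
specialize (H h h1); rewrite Cmod_mult.
assert (h3 := Cmod_ge_0 h).
assert (K * Cmod h ^ 2 <= K * Cmod h) by (apply Rmult_le_compat_l; nra); lra.
Qed.

Lemma quad_diff_comp (F G : C -> C) (s l m : C) :
  quad_diff F s l -> quad_diff G (F s) m -> quad_diff (fun z => G (F z)) s (m * l)%C.
Proof.
intros hF (K2 & d2 & hK2 & hd2 & H2).
destruct (quad_diff_lipschitz F s l hF) as (L & d3 & hL & hd3 & H3).
destruct hF as (K1 & d1 & hK1 & hd1 & H1).
(* The bound [d2 / (L + 1)] keeps the increment [k] of [F] below [d2], so that the expansion of [G]
   at [F s] applies to it. *)
set (d := Rmin (Rmin d1 d3) (d2 / (L + 1))).
assert (hm := Cmod_ge_0 m).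
exists (K2 * L ^ 2 + Cmod m * K1), d; split; [nra|split].
{ repeat apply Rmin_glb_lt; try assumption; apply Rdiv_lt_0_compat; lra. }
intros h hh; assert (h0 := Cmod_ge_0 h).
assert (ha : Cmod h <= d1)
  by (eapply Rle_trans; [exact hh|eapply Rle_trans; [apply Rmin_l|apply Rmin_l]]).
assert (hb : Cmod h <= d3)
  by (eapply Rle_trans; [exact hh|eapply Rle_trans; [apply Rmin_l|apply Rmin_r]]).
assert (hc : Cmod h <= d2 / (L + 1)) by (eapply Rle_trans; [exact hh|apply Rmin_r]).
apply Rle_div_r in hc; [|lra].
specialize (H1 h ha); specialize (H3 h hb).
set (k := (F (s + h) - F s)%C) in *.
replace (F (s + h)%C) with (F s + k)%C by (unfold k; ring).
assert (hk0 := Cmod_ge_0 k).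
assert (hk : Cmod k <= d2) by nra.
specialize (H2 k hk).
replace (G (F s + k) - G (F s) - m * l * h)%C
  with ((G (F s + k) - G (F s) - m * k) + m * (k - l * h))%C by ring.
eapply Rle_trans; [apply Cmod_triangle|]; rewrite Cmod_mult.
assert (Cmod k ^ 2 <= L ^ 2 * Cmod h ^ 2) by (rewrite <- Rpow_mult_distr; apply pow_incr; lra).
assert (K2 * Cmod k ^ 2 <= K2 * (L ^ 2 * Cmod h ^ 2)) by (apply Rmult_le_compat_l; lra).
assert (Cmod m * Cmod (k - l * h)%C <= Cmod m * (K1 * Cmod h ^ 2))
  by (apply Rmult_le_compat_l; lra).
lra.
Qed.

Lemma quad_diff_mult (F G : C -> C) (s l m : C) :
  quad_diff F s l -> quad_diff G s m ->
  quad_diff (fun z => F z * G z)%C s (F s * m + G s * l)%C.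
Proof.
intros hF hG.
destruct (quad_diff_lipschitz F s l hF) as (L1 & d3 & hL1 & hd3 & H3).
destruct (quad_diff_lipschitz G s m hG) as (L2 & d4 & hL2 & hd4 & H4).
destruct hF as (K1 & d1 & hK1 & hd1 & H1).
destruct hG as (K2 & d2 & hK2 & hd2 & H2).
assert (hf := Cmod_ge_0 (F s)); assert (hg := Cmod_ge_0 (G s)).
exists (Cmod (F s) * K2 + Cmod (G s) * K1 + L1 * L2), (Rmin (Rmin d1 d2) (Rmin d3 d4)).
split; [nra|split; [repeat apply Rmin_glb_lt; assumption|intros h hh]].
assert (h0 := Cmod_ge_0 h).
assert (hh' := Rle_trans _ _ _ hh (Rmin_r _ _)).
apply (fun h => Rle_trans _ _ _ h (Rmin_l _ _)) in hh.
specialize (H1 h (Rle_trans _ _ _ hh (Rmin_l _ _))).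
specialize (H2 h (Rle_trans _ _ _ hh (Rmin_r _ _))).
specialize (H3 h (Rle_trans _ _ _ hh' (Rmin_l _ _))).
specialize (H4 h (Rle_trans _ _ _ hh' (Rmin_r _ _))).
(* The last product, of two increments, is quadratic in [h] by the Lipschitz bounds, whence the
   constant [L1 * L2]. *)
replace (F (s + h) * G (s + h) - F s * G s - (F s * m + G s * l) * h)%C
  with (F s * (G (s + h) - G s - m * h) + G s * (F (s + h) - F s - l * h)
        + (F (s + h) - F s) * (G (s + h) - G s))%C by ring.
eapply Rle_trans; [apply Cmod_triangle|].
eapply Rle_trans; [apply Rplus_le_compat_r, Cmod_triangle|].
rewrite !Cmod_mult.
assert (h5 := Rmult_le_compat_l _ _ _ hf H2).
assert (h6 := Rmult_le_compat_l _ _ _ hg H1).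
assert (h7 := Rmult_le_compat _ _ _ _ (Cmod_ge_0 _) (Cmod_ge_0 _) H3 H4).
lra.
Qed.

Lemma quad_diff_inv (s : C) : s <> 0%C -> quad_diff Cinv s (- / (s * s))%C.
Proof.
intros hs; assert (hp := proj1 (Cmod_gt_0 s) hs).
exists (2 / Cmod s ^ 3), (Cmod s / 2).
assert (hp3 := pow_lt _ 3 hp).
split; [apply Rlt_le, Rdiv_lt_0_compat; lra|split; [lra|intros h hh]].
assert (hsh : Cmod s / 2 <= Cmod (s + h)%C).
{ assert (ht := Cmod_triangle (s + h) (- h)); rewrite Cmod_opp in ht.
  replace (s + h + - h)%C with s in ht by ring; lra. }
assert (hn : (s + h)%C <> 0%C) by (apply Cmod_gt_0; lra).
(* The remainder is exactly [h ^ 2 / (s ^ 2 * (s + h))], and [Cmod (s + h)] is at least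
   [Cmod s / 2]. *)
replace (/ (s + h) - / s - - / (s * s) * h)%C
  with (h * h * / (s * s * (s + h)))%C by (field; tauto).
rewrite !Cmod_mult, Cmod_inv, !Cmod_mult by (repeat apply Cmult_neq_0; assumption).
assert (h0 := Cmod_ge_0 h).
replace (2 / Cmod s ^ 3 * Cmod h ^ 2)
  with (Cmod h * Cmod h * / (Cmod s * Cmod s * (Cmod s / 2))) by (field; lra).
apply Rmult_le_compat_l; [nra|].
apply Rinv_le_contravar; [nra|apply Rmult_le_compat_l; nra].
Qed.

(** * The series [H] in the coordinate [s = ln z] *)

(** Componentwise, so that the facts on real [Series] apply; the price is the factor [2] in
    [Cmod_csum_le]. *)
Definition csum (u : nat -> C) : C :=
  (Series (fun n => Re (u n)), Series (fun n => Im (u n))).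

Lemma ex_series_dominated (u b : nat -> R) :
  (forall n, Rabs (u n) <= b n) -> ex_series b -> ex_series u.
Proof. exact (ex_series_le (K := R_AbsRing) (V := R_CompleteNormedModule) u b). Qed.

Lemma Rabs_Series_le (u b : nat -> R) :
  (forall n, Rabs (u n) <= b n) -> ex_series b -> Rabs (Series u) <= Series b.
Proof.
intros h hb; eapply Rle_trans.
- apply Series_Rabs, (ex_series_dominated _ b); [|exact hb].
  intros n; rewrite Rabs_Rabsolu; apply h.
- apply Series_le; [|exact hb]; intros n; split; [apply Rabs_pos|apply h].
Qed.

Definition csummable (u : nat -> C) : Prop := ex_series (fun n => Cmod (u n)).

Lemma csummable_le (u : nat -> C) (b : nat -> R) :
  (forall n, Cmod (u n) <= b n) -> ex_series b -> csummable u.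
Proof.
intros h; apply ex_series_dominated; intros n.
rewrite Rabs_pos_eq by apply Cmod_ge_0; apply h.
Qed.

Lemma csummable_re (u : nat -> C) : csummable u -> ex_series (fun n => Re (u n)).
Proof. apply ex_series_dominated; intros n; apply re_le_Cmod. Qed.

Lemma csummable_im (u : nat -> C) : csummable u -> ex_series (fun n => Im (u n)).
Proof. apply ex_series_dominated; intros n; apply im_le_Cmod. Qed.

Lemma csummable_scal (c : C) (u : nat -> C) :
  csummable u -> csummable (fun n => c * u n)%C.
Proof.
intros h; apply (csummable_le _ (fun n => Cmod c * Cmod (u n))).
- intros n; rewrite Cmod_mult; lra.
- exact (ex_series_scal_l (K := R_AbsRing) (Cmod c) _ h).
Qed.

Lemma csummable_minus (u v : nat -> C) : csummable u -> csummable v ->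
  csummable (fun n => u n - v n)%C.
Proof.
intros hu hv; apply (csummable_le _ (fun n => Cmod (u n) + Cmod (v n))).
- intros n; unfold Cminus; rewrite <- (Cmod_opp (v n)); apply Cmod_triangle.
- exact (ex_series_plus (V := R_NormedModule) _ _ hu hv).
Qed.

Lemma Cmod_csum_le (u : nat -> C) (b : nat -> R) :
  (forall n, Cmod (u n) <= b n) -> ex_series b -> Cmod (csum u) <= 2 * Series b.
Proof.
intros h hb; eapply Rle_trans; [apply Cmod_le_Re_Im|].
unfold csum; simpl Re; simpl Im.
assert (h1 := Rabs_Series_le (fun n => Re (u n)) b
  (fun n => Rle_trans _ _ _ (re_le_Cmod _) (h n)) hb).
assert (h2 := Rabs_Series_le (fun n => Im (u n)) b
  (fun n => Rle_trans _ _ _ (im_le_Cmod _) (h n)) hb).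
lra.
Qed.

Lemma csum_minus (u v : nat -> C) : csummable u -> csummable v ->
  csum (fun n => u n - v n)%C = (csum u - csum v)%C.
Proof.
intros hu hv; apply injective_projections; simpl.
- rewrite <- Series_opp, <- Series_plus.
  + reflexivity.
  + apply csummable_re, hu.
  + apply (ex_series_opp (V := R_NormedModule)), csummable_re, hv.
- rewrite <- Series_opp, <- Series_plus.
  + reflexivity.
  + apply csummable_im, hu.
  + apply (ex_series_opp (V := R_NormedModule)), csummable_im, hv.
Qed.

Lemma csum_scal (c : C) (u : nat -> C) : csummable u ->
  csum (fun n => c * u n)%C = (c * csum u)%C.
Proof.
intros hu; assert (h1 := csummable_re u hu); assert (h2 := csummable_im u hu).
assert (hs : forall (k : R) v, ex_series v -> ex_series (fun n => k * v n))
  by (intros k v hv; exact (ex_series_scal_l (K := R_AbsRing) k v hv)).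
apply injective_projections; simpl.
- rewrite <- !Series_scal_l, <- Series_minus by (apply hs; assumption); reflexivity.
- rewrite <- !Series_scal_l, <- Series_plus by (apply hs; assumption); reflexivity.
Qed.

Section Dirichlet.

Variables a e : nat -> R.
Hypothesis ha : forall n, 0 < a n.
Hypothesis hsum : ex_series a.
Hypothesis he : forall n, 0 <= e n <= 1.

(** This is [H]: with [s = ln z], the factor [cexp (e n * s)] is [z ^ (e n)]. Its values on the
    positive axis are given by [dirichlet_re], with [x = ln |z|]. *)
Definition dirichlet (s : C) : C := csum (fun n => a n * cexp (e n * s))%C.
Definition dirichlet_re (x : R) : R := Series (fun n => a n * exp (e n * x)).

Lemma dirichlet_term_le (x : R) n : exp (e n * x) <= exp (Rabs x).
Proof.
destruct (Req_dec (e n * x) (Rabs x)) as [->|hn]; [lra|].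
apply Rlt_le, exp_increasing; assert (h := Rle_abs x); assert (h1 := Rabs_pos x).
specialize (he n).
assert (e n * x <= Rabs x) by (destruct (Rle_or_lt 0 x); nra); lra.
Qed.

(** Used with [w = 1] for the series itself and with [w = e] for its termwise derivative. *)
Lemma ex_dirichlet_weighted (w : nat -> R) (x : R) : (forall n, 0 <= w n <= 1) ->
  ex_series (fun n => a n * w n * exp (e n * x)).
Proof.
intros hw; apply (ex_series_dominated _ (fun n => exp (Rabs x) * a n)).
- intros n; specialize (ha n); specialize (hw n).
  assert (h := exp_pos (e n * x)); assert (h2 := dirichlet_term_le x n).
  rewrite Rabs_pos_eq by (repeat apply Rmult_le_pos; lra).
  rewrite (Rmult_comm (exp _)), Rmult_assoc.
  apply Rmult_le_compat_l; [lra|].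
  apply Rle_trans with (1 * exp (e n * x)); [apply Rmult_le_compat_r|]; lra.
- exact (ex_series_scal_l (K := R_AbsRing) (exp (Rabs x)) _ hsum).
Qed.

Lemma ex_dirichlet_re (x : R) : ex_series (fun n => a n * exp (e n * x)).
Proof.
apply (ex_series_ext (V := R_NormedModule) (fun n => a n * 1 * exp (e n * x))).
- intros n; now rewrite Rmult_1_r.
- apply (ex_dirichlet_weighted (fun _ => 1)); intros n; lra.
Qed.

Lemma Cmod_dirichlet_term (s : C) n :
  Cmod (a n * cexp (e n * s))%C = a n * exp (e n * Re s).
Proof.
rewrite Cmod_mult, Cmod_cexp, Cmod_R, Rabs_pos_eq by (apply Rlt_le, ha).
unfold Re; simpl; do 2 f_equal; ring.
Qed.

Lemma csummable_dirichlet (s : C) : csummable (fun n => a n * cexp (e n * s))%C.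
Proof.
apply (csummable_le _ (fun n => a n * exp (e n * Re s))); [|apply ex_dirichlet_re].
intros n; rewrite Cmod_dirichlet_term; lra.
Qed.

Lemma dirichlet_re_pos (x : R) n : 0 < a n * exp (e n * x) <= dirichlet_re x.
Proof.
assert (hp : forall n, 0 < a n * exp (e n * x))
  by (intros m; apply Rmult_lt_0_compat; [apply ha|apply exp_pos]).
split; [apply hp|].
unfold dirichlet_re.
apply Rle_trans with (sum_f_R0 (fun n => a n * exp (e n * x)) n).
- destruct n; simpl; [lra|].
  assert (0 <= sum_f_R0 (fun n => a n * exp (e n * x)) n)
    by (apply cond_pos_sum; intros m; apply Rlt_le, hp); lra.
- rewrite <- sum_n_Reals; apply is_lim_seq_incr_compare.
  + apply Series_correct, ex_dirichlet_re.
  + intros m; rewrite sum_Sn; specialize (hp (S m)); unfold plus; simpl; lra.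
Qed.

(** Termwise differentiation: as [e n <= 1], each term has a quadratic remainder with constant [5]
    times its modulus at [s]. These moduli sum to [D], and [Cmod_csum_le] doubles the constant. *)
Lemma quad_diff_dirichlet (s : C) : exists l, quad_diff dirichlet s l.
Proof.
set (D := dirichlet_re (Re s)).
exists (csum (fun n => e n * (a n * cexp (e n * s)))%C), (10 * D), (/ 2).
assert (hD := dirichlet_re_pos (Re s) 0); fold D in hD.
split; [lra|split; [lra|intros h hh]].
assert (hs : csummable (fun n => e n * (a n * cexp (e n * s)))%C).
{ apply (csummable_le _ (fun n => a n * exp (e n * Re s))); [|apply ex_dirichlet_re].
  intros n; rewrite Cmod_mult, Cmod_dirichlet_term, Cmod_R.
  destruct (dirichlet_re_pos (Re s) n) as [h1 _]; specialize (he n).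
  rewrite Rabs_pos_eq by lra; nra. }
rewrite (Cmult_comm (csum _) h), <- csum_scal by exact hs.
assert (hs' := csummable_scal h _ hs).
unfold dirichlet; rewrite <- csum_minus by apply csummable_dirichlet.
assert (hb : forall n,
  Cmod ((a n * cexp (e n * (s + h)) - a n * cexp (e n * s))
        - h * (e n * (a n * cexp (e n * s))))%C
   <= 5 * Cmod h ^ 2 * (a n * exp (e n * Re s))).
{ intros n; replace (e n * (s + h))%C with (e n * s + e n * h)%C by ring.
  rewrite cexp_plus.
  replace (a n * (cexp (e n * s) * cexp (e n * h)) - a n * cexp (e n * s)
        - h * (e n * (a n * cexp (e n * s))))%C
   with ((a n * cexp (e n * s)) * (cexp (e n * h) - 1 - e n * h))%C by ring.
  rewrite Cmod_mult, Cmod_dirichlet_term, Rmult_comm.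
  apply Rmult_le_compat_r; [apply Rlt_le, dirichlet_re_pos|].
  assert (hm : Cmod (e n * h)%C <= Cmod h).
  { rewrite Cmod_mult, Cmod_R, Rabs_pos_eq by apply he.
    specialize (he n); assert (h0 := Cmod_ge_0 h); nra. }
  eapply Rle_trans; [apply cexp_taylor1; lra|].
  apply Rmult_le_compat_l; [lra|]; apply pow_incr; split; [apply Cmod_ge_0|exact hm]. }
rewrite <- csum_minus;
  [|apply csummable_minus; apply csummable_dirichlet|exact hs'].
eapply Rle_trans; [apply Cmod_csum_le; [exact hb|]|].
- exact (ex_series_scal_l (K := R_AbsRing) (5 * Cmod h ^ 2) _ (ex_dirichlet_re (Re s))).
- rewrite Series_scal_l; fold (dirichlet_re (Re s)) D; lra.
Qed.

Lemma dirichlet_re_le (s : C) : Rabs (Re (dirichlet s)) <= dirichlet_re (Re s).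
Proof.
apply Rabs_Series_le; [|apply ex_dirichlet_re]; intros n.
rewrite <- Cmod_dirichlet_term; apply re_le_Cmod.
Qed.

Lemma dirichlet_im_le (s : C) : Rabs (Im (dirichlet s)) <= dirichlet_re (Re s).
Proof.
apply Rabs_Series_le; [|apply ex_dirichlet_re]; intros n.
rewrite <- Cmod_dirichlet_term; apply im_le_Cmod.
Qed.

Lemma re_dirichlet_term (s : C) n :
  Re (a n * cexp (e n * s))%C = a n * exp (e n * Re s) * cos (e n * Im s).
Proof.
unfold cexp, Re, Im; simpl.
replace (e n * fst s - 0 * snd s) with (e n * fst s) by ring.
replace (e n * snd s + 0 * fst s) with (e n * snd s) by ring.
ring.
Qed.

Lemma im_dirichlet_term (s : C) n :
  Im (a n * cexp (e n * s))%C = a n * exp (e n * Re s) * sin (e n * Im s).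
Proof.
unfold cexp, Re, Im; simpl.
replace (e n * fst s - 0 * snd s) with (e n * fst s) by ring.
replace (e n * snd s + 0 * fst s) with (e n * snd s) by ring.
ring.
Qed.

(** Every angle [e n * Im s] has cosine at least [1 / 2], so the terms cannot cancel; this is why
    [dirichlet] has no zero there. *)
Lemma dirichlet_re_ge (s : C) : (forall n, Rabs (e n * Im s) <= 1) ->
  dirichlet_re (Re s) / 2 <= Re (dirichlet s).
Proof.
intros hs; unfold dirichlet_re.
change (Re (dirichlet s)) with (Series (fun n => Re (a n * cexp (e n * s))%C)).
unfold Rdiv; rewrite <- Series_scal_r; apply Series_le.
- intros n; rewrite re_dirichlet_term.
  destruct (dirichlet_re_pos (Re s) n) as [h _].
  split; [lra|apply Rmult_le_compat_l; [lra|]].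
  eapply Rle_trans; [|apply cos_taylor1].
  assert (h1 := hs n); apply Rabs_le_between in h1; nra.
- apply csummable_re, csummable_dirichlet.
Qed.

(** From [|sin t| <= |t|] in each term. The series on the right is the derivative of [dirichlet_re]
    at [Re s], which will be small compared with [dirichlet_re] near the vertex. *)
Lemma dirichlet_im_le_weighted (s : C) : Rabs (Im (dirichlet s)) <=
  Rabs (Im s) * Series (fun n => a n * e n * exp (e n * Re s)).
Proof.
change (Im (dirichlet s)) with (Series (fun n => Im (a n * cexp (e n * s))%C)).
rewrite <- Series_scal_l; apply Rabs_Series_le.
- intros n; rewrite im_dirichlet_term.
  destruct (dirichlet_re_pos (Re s) n) as [h _].
  rewrite Rabs_mult, (Rabs_pos_eq (_ * _)) by lra.
  replace (Rabs (Im s) * (a n * e n * exp (e n * Re s)))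
    with (a n * exp (e n * Re s) * (e n * Rabs (Im s))) by ring.
  apply Rmult_le_compat_l; [lra|].
  rewrite <- (Rabs_pos_eq (e n)) at 2 by apply he; rewrite <- Rabs_mult.
  apply Rabs_sin_le.
- exact (ex_series_scal_l (K := R_AbsRing) (Rabs (Im s)) _
    (ex_dirichlet_weighted e (Re s) he)).
Qed.

Hypothesis he_decr : forall n, e (S n) < e n.
Hypothesis he_lim : is_lim_seq e 0.

Lemma e_antitone n m : (n <= m)%nat -> e m <= e n.
Proof.
induction 1 as [|m _ IH]; [lra|].
specialize (he_decr m); lra.
Qed.

(* As [x] tends to [-oo] the terms with small exponents dominate, so the
   logarithmic derivative of the series tends to [0]. *)
Lemma dirichlet_log_derivative (eta : R) : 0 < eta -> exists x0, forall x, x <= x0 ->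
  Series (fun n => a n * e n * exp (e n * x)) <= eta * dirichlet_re x.
Proof.
intros heta.
destruct (proj2 (is_lim_seq_spec e 0) he_lim (mkposreal _ (Rdiv_lt_0_compat _ 2 heta ltac:(lra))))
  as [N0 hN0].
(* The terms up to [N] will be absorbed by the single term of index [N']; from [N'] on, the
   exponents are at most [eta / 2]. *)
set (N := S N0); set (N' := S N).
assert (hN : e N' <= eta / 2).
{ specialize (hN0 N' ltac:(unfold N', N; lia)); simpl in hN0.
  rewrite Rminus_0_r in hN0; apply Rabs_lt_between in hN0; lra. }
set (A := Series a).
assert (hA : 0 < A).
{ apply Rlt_le_trans with (dirichlet_re 0); [|right; apply Series_ext].
  - apply Rlt_le_trans with (2 := proj2 (dirichlet_re_pos 0 0)); apply dirichlet_re_pos.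
  - intros n; rewrite Rmult_0_r, exp_0; ring. }
set (delta := e N - e N').
assert (hdelta : 0 < delta) by (unfold delta, N'; specialize (he_decr N); lra).
(* Once [exp (x * delta) <= q], the quantity [exp (e N * x) * A] is at most [eta / 2] times the term
   of index [N']. *)
set (q := eta / 2 * a N' / A).
assert (hq : 0 < q).
{ apply Rdiv_lt_0_compat; [|exact hA]; apply Rmult_lt_0_compat; [lra|apply ha]. }
(* The bound [x <= 0] gives [exp (e n * x) <= exp (e N * x)] for [n <= N], since the exponents
   decrease. *)
exists (Rmin 0 (ln q / delta)); intros x hx.
assert (hx0 := Rle_trans _ _ _ hx (Rmin_l _ _)).
assert (hx1 := Rle_trans _ _ _ hx (Rmin_r _ _)).
apply Rle_div_r in hx1; [|exact hdelta].
assert (hsmall : exp (e N * x) * A <= eta / 2 * dirichlet_re x).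
{ replace (e N * x) with (x * delta + e N' * x) by (unfold delta; ring).
  rewrite exp_plus.
  assert (h1 : exp (x * delta) <= q).
  { rewrite <- (exp_ln q hq); destruct hx1 as [h| ->]; [|lra].
    apply Rlt_le, exp_increasing, h. }
  assert (h2 := dirichlet_re_pos x N'); assert (h3 := exp_pos (e N' * x)).
  apply Rle_trans with (q * exp (e N' * x) * A).
  - apply Rmult_le_compat_r; [lra|apply Rmult_le_compat_r; lra].
  - replace (q * exp (e N' * x) * A) with (eta / 2 * (a N' * exp (e N' * x)))
      by (unfold q; field; lra).
    apply Rmult_le_compat_l; lra. }
apply Rle_trans with (eta / 2 * dirichlet_re x + exp (e N * x) * A); [|lra].
assert (hs1 := ex_series_scal_l (K := R_AbsRing) (eta / 2) _ (ex_dirichlet_re x)).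
assert (hs2 := ex_series_scal_l (K := R_AbsRing) (exp (e N * x)) _ hsum).
unfold dirichlet_re, A; rewrite <- !Series_scal_l.
rewrite <- Series_plus by assumption.
apply Series_le; [|exact (ex_series_plus (V := R_NormedModule) _ _ hs1 hs2)].
intros n; assert (hen := he n); assert (han := ha n); assert (hx' := exp_pos (e n * x)).
split; [repeat apply Rmult_le_pos; lra|].
assert (h1 : 0 <= a n * exp (e n * x)) by (apply Rmult_le_pos; lra).
assert (h2 : 0 <= exp (e N * x) * a n)
  by (apply Rmult_le_pos; [apply Rlt_le, exp_pos|lra]).
destruct (Nat.le_gt_cases n N) as [h|h].
- assert (h3 : exp (e n * x) <= exp (e N * x)).
  { assert (h4 : e n * x <= e N * x) by (assert (h5 := e_antitone n N h); nra).
    destruct h4 as [h4| ->]; [apply Rlt_le, exp_increasing, h4|lra]. }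
  assert (a n * exp (e n * x) <= a n * exp (e N * x)) by (apply Rmult_le_compat_l; lra).
  assert (a n * exp (e n * x) * e n <= a n * exp (e n * x) * 1) by (apply Rmult_le_compat_l; lra).
  assert (0 <= eta / 2 * (a n * exp (e n * x))) by (apply Rmult_le_pos; lra).
  lra.
- assert (h3 := e_antitone N' n h).
  assert (a n * exp (e n * x) * e n <= a n * exp (e n * x) * (eta / 2))
    by (apply Rmult_le_compat_l; lra).
  lra.
Qed.

(** * The exponent [z ^ (- rho) / H z] and bounds for its real part *)

Variable rho : R.

Definition flat_exponent (s : C) : C := (cexp (- rho * s) * / dirichlet s)%C.

(** The inverse of [dirichlet s] is its conjugate over its squared modulus, and [cexp (- rho * s)]
    has argument [- rho * Im s]. *)
Lemma re_flat_exponent (s : C) : Re (flat_exponent s) =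
  exp (- rho * Re s) *
  (cos (rho * Im s) * Re (dirichlet s) - sin (rho * Im s) * Im (dirichlet s))
  / Cmod (dirichlet s) ^ 2.
Proof.
unfold flat_exponent; rewrite Cmod_sqr; destruct (dirichlet s) as [p q].
destruct s as [x y]; unfold cexp, Re, Im; simpl.
replace (- rho * x - - 0 * y) with (- rho * x) by ring.
replace (- rho * y + - 0 * x) with (- (rho * y)) by ring.
rewrite cos_neg, sin_neg; unfold Rdiv; ring.
Qed.

Section Point.

Variable s : C.
Hypothesis hs : forall n, Rabs (e n * Im s) <= 1.

Lemma dirichlet_neq_0 : dirichlet s <> 0%C.
Proof.
intros h; assert (h1 := dirichlet_re_ge s hs); rewrite h in h1; simpl in h1.
assert (h2 := dirichlet_re_pos (Re s) 0); lra.
Qed.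

Lemma Cmod_dirichlet_between : let D := dirichlet_re (Re s) in
  D ^ 2 / 4 <= Cmod (dirichlet s) ^ 2 <= 2 * D ^ 2.
Proof.
intros D; rewrite Cmod_sqr.
assert (hD := dirichlet_re_pos (Re s) 0).
assert (h1 := dirichlet_re_ge s hs).
assert (h2 := dirichlet_re_le s); assert (h3 := dirichlet_im_le s).
apply Rabs_le_between in h2; apply Rabs_le_between in h3.
fold D in hD, h1, h2, h3; nra.
Qed.

(** A crude bound, for use away from the vertex: the bracket in [re_flat_exponent] is at most
    [2 * D] in absolute value, and the denominator is at least [D ^ 2 / 4]. *)
Lemma re_flat_exponent_ge_all :
  - (8 * (exp (- rho * Re s) / dirichlet_re (Re s))) <= Re (flat_exponent s).
Proof.
rewrite re_flat_exponent.
assert (hD := dirichlet_re_pos (Re s) 0).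
destruct Cmod_dirichlet_between as [hm _].
assert (h2 := dirichlet_re_le s); assert (h3 := dirichlet_im_le s).
set (D := dirichlet_re (Re s)) in *; set (E := exp (- rho * Re s)).
assert (hE : 0 < E) by apply exp_pos.
set (m := Cmod (dirichlet s) ^ 2) in *.
set (c := cos (rho * Im s)); set (t := sin (rho * Im s)).
set (p := Re (dirichlet s)) in *; set (q := Im (dirichlet s)) in *.
assert (hc : Rabs c <= 1) by apply Rabs_le_between, COS_bound.
assert (ht : Rabs t <= 1) by apply Rabs_le_between, SIN_bound.
assert (hD2 : 0 < D ^ 2) by (apply pow_lt; lra).
assert (hcp : Rabs (c * p) <= 1 * D)
  by (rewrite Rabs_mult; apply Rmult_le_compat; try apply Rabs_pos; assumption).
assert (htq : Rabs (t * q) <= 1 * D)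
  by (rewrite Rabs_mult; apply Rmult_le_compat; try apply Rabs_pos; assumption).
apply Rabs_le_between in hcp; apply Rabs_le_between in htq.
apply (Rle_div_r _ _ m); [lra|].
apply Rle_trans with (- (2 * E * D)); [|nra].
replace (- (8 * (E / D)) * m) with (- (8 * (E / D) * m)) by ring.
apply Ropp_le_contravar.
replace (2 * E * D) with (8 * (E / D) * (D ^ 2 / 4)) by (field; lra).
apply Rmult_le_compat_l; [|lra].
apply Rmult_le_pos; [lra|]; apply Rlt_le, Rdiv_lt_0_compat; lra.
Qed.

End Point.

(** The cosine stays above [c0 > 0], and near the vertex the imaginary part of [dirichlet s] is at
    most [c0 / 4 * D]. So the bracket is at least [c0 / 2 * D - c0 / 4 * D]; dividing by at most
    [2 * D ^ 2] yields [kappa = c0 / 8]. *)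
Lemma re_flat_exponent_ge_near (beta : R) : 0 <= beta -> 0 < rho ->
  rho * beta < PI / 2 -> (forall n, e n * beta <= 1) ->
  exists kappa x0, 0 < kappa <= 1 /\ forall s : C, Rabs (Im s) <= beta -> Re s <= x0 ->
    kappa * (exp (- rho * Re s) / dirichlet_re (Re s)) <= Re (flat_exponent s).
Proof.
intros hbeta hrho hrb heb.
set (c0 := cos (rho * beta)).
assert (hrb0 : 0 <= rho * beta) by (apply Rmult_le_pos; lra).
assert (hc0 : 0 < c0 <= 1) by (split; [apply cos_gt_0; lra|apply COS_bound]).
(* This choice makes [beta * eta <= c0 / 4]; the shift [beta + 1] covers [beta = 0]. *)
destruct (dirichlet_log_derivative (c0 / (4 * (beta + 1)))) as [x0 hx0].
{ apply Rdiv_lt_0_compat; lra. }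
exists (c0 / 8), x0; split; [lra|]; intros s hs hre.
rewrite re_flat_exponent.
assert (hes : forall n, Rabs (e n * Im s) <= 1).
{ intros n; rewrite Rabs_mult, Rabs_pos_eq by apply he.
  apply Rle_trans with (2 := heb n); apply Rmult_le_compat_l; [apply he|exact hs]. }
assert (hD := dirichlet_re_pos (Re s) 0).
destruct (Cmod_dirichlet_between s hes) as [hm1 hm2].
assert (h1 := dirichlet_re_ge s hes).
assert (h2 := dirichlet_im_le_weighted s).
specialize (hx0 _ hre).
set (D := dirichlet_re (Re s)) in *; set (E := exp (- rho * Re s)).
assert (hE : 0 < E) by apply exp_pos.
set (m := Cmod (dirichlet s) ^ 2) in *.
set (W := Series _) in *.
assert (hD2 : 0 < D ^ 2) by (apply pow_lt; lra).
assert (hq : Rabs (Im (dirichlet s)) <= c0 / 4 * D).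
{ eapply Rle_trans; [exact h2|].
  apply Rle_trans with (beta * (c0 / (4 * (beta + 1)) * D)).
  - apply Rle_trans with (Rabs (Im s) * (c0 / (4 * (beta + 1)) * D)).
    + apply Rmult_le_compat_l; [apply Rabs_pos|exact hx0].
    + apply Rmult_le_compat_r; [|exact hs].
      apply Rmult_le_pos; [apply Rlt_le, Rdiv_lt_0_compat|]; lra.
  - replace (beta * (c0 / (4 * (beta + 1)) * D)) with (beta / (beta + 1) * (c0 / 4 * D))
      by (field; lra).
    rewrite <- (Rmult_1_l (c0 / 4 * D)) at 2.
    apply Rmult_le_compat_r; [apply Rmult_le_pos; lra|].
    apply Rle_div_l; lra. }
assert (hc : c0 <= cos (rho * Im s)).
{ assert (hr : Rabs (rho * Im s) <= rho * beta)
    by (rewrite Rabs_mult, Rabs_pos_eq by lra; apply Rmult_le_compat_l; lra).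
  assert (hpi := PI_RGT_0).
  assert (habs : cos (rho * Im s) = cos (Rabs (rho * Im s)))
    by (unfold Rabs; destruct Rcase_abs; [symmetry; apply cos_neg|reflexivity]).
  rewrite habs; apply cos_decr_1; try apply Rabs_pos; lra. }
set (c := cos (rho * Im s)) in *; set (t := sin (rho * Im s)).
set (p := Re (dirichlet s)) in *; set (q := Im (dirichlet s)) in *.
assert (ht : Rabs t <= 1) by apply Rabs_le_between, SIN_bound.
assert (htq : Rabs (t * q) <= 1 * (c0 / 4 * D))
  by (rewrite Rabs_mult; apply Rmult_le_compat; try apply Rabs_pos; assumption).
apply Rabs_le_between in htq.
assert (hcp : c0 * (D / 2) <= c * p) by (apply Rmult_le_compat; lra).
apply (Rle_div_r _ _ m); [lra|].
apply Rle_trans with (E * (c0 / 4 * D)); [|apply Rmult_le_compat_l; lra].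
replace (E * (c0 / 4 * D)) with (c0 / 8 * (E / D) * (2 * D ^ 2)) by (field; lra).
apply Rmult_le_compat_l; [|exact hm2].
apply Rmult_le_pos; [lra|]; apply Rlt_le, Rdiv_lt_0_compat; lra.
Qed.

Lemma quad_diff_flat_exponent (s : C) : (forall n, Rabs (e n * Im s) <= 1) ->
  exists l, quad_diff flat_exponent s l.
Proof.
intros hs; destruct (quad_diff_dirichlet s) as [l hl].
eexists; apply (quad_diff_mult (fun z => cexp (- rho * z)) (fun z => / dirichlet z)%C).
- apply (quad_diff_comp (fun z => - rho * z)%C cexp);
    [apply quad_diff_lin|apply quad_diff_cexp].
- apply (quad_diff_comp dirichlet Cinv);
    [exact hl|apply quad_diff_inv, dirichlet_neq_0, hs].
Qed.

Lemma dirichlet_re_le_mono (x y : R) : x <= y -> dirichlet_re x <= dirichlet_re y.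
Proof.
intros hxy; apply Series_le; [|apply ex_dirichlet_re]; intros n.
assert (h := dirichlet_re_pos x n); split; [lra|].
apply Rmult_le_compat_l; [apply Rlt_le, ha|].
assert (h1 : e n * x <= e n * y) by (apply Rmult_le_compat_l; [apply he|exact hxy]).
destruct h1 as [h1| ->]; [apply Rlt_le, exp_increasing, h1|lra].
Qed.

End Dirichlet.

(** * The Riemann surface of the logarithm *)

(** Taken with [G = cexp], it passes from differentiability in the logarithmic coordinate to
    differentiability with respect to [proj]. *)
Lemma quad_diff_quotient (F G : C -> C) (s l m : C) :
  quad_diff F s l -> quad_diff G s m -> m <> 0%C ->
  exists K d : R, 0 <= K /\ 0 < d /\ forall h : C, h <> 0%C -> Cmod h <= d ->
    Cmod ((F (s + h) - F s) / (G (s + h) - G s) - l / m)%C <= K * Cmod h.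
Proof.
intros (K1 & d1 & hK1 & hd1 & H1) (K2 & d2 & hK2 & hd2 & H2) hm.
assert (hm' := proj1 (Cmod_gt_0 m) hm); assert (hl := Cmod_ge_0 l).
set (C0 := K1 * Cmod m + Cmod l * K2).
assert (hC0 : 0 <= C0) by (unfold C0; nra).
(* The last bound on [h] gives [K2 * Cmod h <= Cmod m / 2], so the increment [v] of [G] is at least
   [Cmod m / 2 * Cmod h] in modulus and does not vanish. *)
exists (C0 / (Cmod m * (Cmod m / 2))), (Rmin (Rmin d1 d2) (Cmod m / (2 * (K2 + 1)))).
split; [apply Rdiv_le_0_compat; nra|split].
{ repeat apply Rmin_glb_lt; try assumption; apply Rdiv_lt_0_compat; lra. }
intros h hn hh; assert (h0 := proj1 (Cmod_gt_0 h) hn).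
assert (hh' := Rle_trans _ _ _ hh (Rmin_r _ _)).
apply (fun h => Rle_trans _ _ _ h (Rmin_l _ _)) in hh.
specialize (H1 h (Rle_trans _ _ _ hh (Rmin_l _ _))).
specialize (H2 h (Rle_trans _ _ _ hh (Rmin_r _ _))).
apply Rle_div_r in hh'; [|lra].
set (u := (F (s + h) - F s)%C) in *; set (v := (G (s + h) - G s)%C) in *.
assert (hv : Cmod m / 2 * Cmod h <= Cmod v).
{ assert (ht := Cmod_triangle v (- (v - m * h))).
  rewrite Cmod_opp in ht.
  replace (v + - (v - m * h))%C with (m * h)%C in ht by ring.
  rewrite Cmod_mult in ht; nra. }
assert (hmh : 0 < Cmod m / 2 * Cmod h) by (apply Rmult_lt_0_compat; lra).
assert (hv0 : v <> 0%C) by (apply Cmod_gt_0; lra).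
replace (u / v - l / m)%C with (((u - l * h) * m - l * (v - m * h)) / (m * v))%C
  by (field; tauto).
unfold Cdiv; rewrite Cmod_mult, Cmod_inv, Cmod_mult by (apply Cmult_neq_0; assumption).
assert (hnum : Cmod ((u - l * h) * m - l * (v - m * h))%C <= C0 * Cmod h ^ 2).
{ unfold Cminus at 1; eapply Rle_trans; [apply Cmod_triangle|].
  rewrite Cmod_opp, !Cmod_mult.
  assert (p1 := Rmult_le_compat_r _ _ _ (Rlt_le _ _ hm') H1).
  assert (p2 := Rmult_le_compat_l _ _ _ hl H2).
  unfold C0; lra. }
apply Rle_trans with (C0 * Cmod h ^ 2 * / (Cmod m * (Cmod m / 2 * Cmod h))).
- apply Rmult_le_compat; [apply Cmod_ge_0| |exact hnum|].
  + apply Rlt_le, Rinv_0_lt_compat, Rmult_lt_0_compat; [lra|]; nra.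
  + apply Rinv_le_contravar; [apply Rmult_lt_0_compat|apply Rmult_le_compat_l]; lra.
- right; field; lra.
Qed.

(** The global chart [ln z] of the surface: in it [proj] becomes [cexp], and the power [z ^ c]
    becomes [cexp (c * s)]. *)
Definition log_coord (z : surface) : C := (ln (modulus z), arg z).

Lemma proj_cexp (z : surface) : on_surface z -> proj z = cexp (log_coord z).
Proof.
intros hz; unfold proj, cexp, log_coord; simpl; rewrite exp_ln by exact hz; reflexivity.
Qed.

Lemma log_coord_inj (z w : surface) : on_surface z -> on_surface w ->
  log_coord z = log_coord w -> z = w.
Proof.
intros hz hw h; injection h; intros h2 h1.
apply injective_projections; [apply ln_inv; assumption|exact h2].
Qed.

Lemma log_coord_continuous (z0 : surface) (eps : R) : on_surface z0 -> 0 < eps ->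
  locally z0 (fun z => on_surface z /\ Cmod (log_coord z - log_coord z0)%C <= eps).
Proof.
intros hz heps.
assert (hc : continuous ln (modulus z0)).
{ apply (ex_derive_continuous (V := R_NormedModule)); eexists; apply is_derive_ln, hz. }
assert (heps2 : 0 < eps / 2) by lra.
destruct (proj1 (filterlim_locally _ _) hc (mkposreal _ heps2)) as [d1 h1].
(* The radius [modulus z0] keeps nearby moduli positive, that is, nearby points on the surface. *)
assert (hd : 0 < Rmin (Rmin d1 (modulus z0)) (eps / 2))
  by (repeat apply Rmin_glb_lt; [apply cond_pos|exact hz|lra]).
exists (mkposreal _ hd); intros z [hz1 hz2].
change (Rabs (modulus z - modulus z0) < Rmin (Rmin d1 (modulus z0)) (eps / 2)) in hz1.
change (Rabs (arg z - arg z0) < Rmin (Rmin d1 (modulus z0)) (eps / 2)) in hz2.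
assert (hr := Rlt_le_trans _ _ _ hz1 (Rmin_l _ _)).
assert (ha := Rlt_le_trans _ _ _ hz2 (Rmin_r _ _)).
assert (hr1 := Rlt_le_trans _ _ _ hr (Rmin_l _ _)).
assert (hr2 := Rlt_le_trans _ _ _ hr (Rmin_r _ _)).
split; [apply Rabs_lt_between in hr2; unfold on_surface; lra|].
specialize (h1 (modulus z) hr1).
change (Rabs (ln (modulus z) - ln (modulus z0)) < eps / 2) in h1.
eapply Rle_trans; [apply Cmod_le_Re_Im|].
change (Rabs (ln (modulus z) - ln (modulus z0)) + Rabs (arg z - arg z0) <= eps); lra.
Qed.

Lemma holomorphic_on_log_coord (U : surface -> Prop) (F : C -> C) :
  (forall z, U z -> on_surface z /\ exists l, quad_diff F (log_coord z) l) ->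
  holomorphic_on U (fun z => F (log_coord z)).
Proof.
intros H z0 hU; destruct (H z0 hU) as [hz0 [l hl]].
destruct (quad_diff_quotient F cexp _ l _ hl (quad_diff_cexp _) (cexp_neq_0 _))
  as (K & d & hK & hd & hq).
exists (l / cexp (log_coord z0))%C.
apply filterlim_locally; intros eps.
set (d' := Rmin d (eps / (K + 1) / 2)).
assert (hd' : 0 < d').
{ apply Rmin_glb_lt; [exact hd|].
  apply Rdiv_lt_0_compat; [apply Rdiv_lt_0_compat; [apply cond_pos|lra]|lra]. }
unfold locally', within.
generalize (log_coord_continuous z0 d' hz0 hd'); apply filter_imp.
intros z [hz hh] hne.
set (h := (log_coord z - log_coord z0)%C) in *.
assert (e : log_coord z = (log_coord z0 + h)%C) by (unfold h; ring).
(* The limit is taken over a punctured neighbourhood, and the chart is injective. *)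
assert (hn : h <> 0%C).
{ intros h0; apply hne, log_coord_inj; [assumption..|].
  rewrite e, h0; ring. }
specialize (hq h hn (Rle_trans _ _ _ hh (Rmin_l _ _))).
rewrite <- e in hq.
rewrite (proj_cexp z hz), (proj_cexp z0 hz0).
set (q := ((F (log_coord z) - _) / _)%C) in *; set (L := (l / _)%C) in *.
assert (hlt : Cmod (q - L)%C < eps).
{ eapply Rle_lt_trans; [exact hq|].
  assert (h1 := Rle_trans _ _ _ hh (Rmin_r _ _)).
  assert (heps := cond_pos eps).
  apply Rle_lt_trans with ((K + 1) * (eps / (K + 1) / 2)).
  - apply Rmult_le_compat; [lra|apply Cmod_ge_0|lra|exact h1].
  - replace ((K + 1) * (eps / (K + 1) / 2)) with (eps / 2) by (field; lra); lra. }
split.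
- change (Rabs (Re (q - L)%C) < eps); eapply Rle_lt_trans; [apply re_le_Cmod|exact hlt].
- change (Rabs (Im (q - L)%C) < eps); eapply Rle_lt_trans; [apply im_le_Cmod|exact hlt].
Qed.

(** The closure of [T] contains points on both of its sides, so the two extreme arguments lie
    strictly inside the sector; [beta] is the larger of their absolute values. *)
Lemma proper_subsector_arg_bound (T : surface -> Prop) (gamma : R) :
  proper_subsector T gamma -> exists beta, 0 <= beta < gamma * PI / 2 /\
    forall z, T z -> on_surface z /\ Rabs (arg z) <= beta.
Proof.
intros [(d & alpha & r & halpha & hr & hT) hcl].
assert (hap : 0 < alpha * PI / 2)
  by (assert (h := Rmult_lt_0_compat _ _ halpha PI_RGT_0); lra).
set (b := alpha * PI / 2) in *.
assert (hedge : forall u, u = 1 \/ u = -1 -> Rabs (d + u * b) < gamma * PI / 2).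
{ intros u hu; apply (hcl (r / 2, d + u * b)); split; [unfold on_surface; simpl; lra|].
  intros P [eps hP].
  assert (heps := cond_pos eps).
  (* The side is approached from inside [T] by an angle [t]; [t <= b] prevents overshooting the
     bisecting direction. *)
  set (t := Rmin (eps / 2) b).
  assert (ht : 0 < t) by (apply Rmin_glb_lt; lra).
  assert (ht1 : t <= eps / 2) by apply Rmin_l.
  assert (ht2 : t <= b) by apply Rmin_r.
  exists (r / 2, d + u * (b - t)); split.
  - apply hP; split.
    + apply ball_center.
    + change (Rabs (d + u * (b - t) - (d + u * b)) < eps).
      apply Rabs_lt_between; destruct hu; subst u; lra.
  - apply hT; split; [unfold on_surface; simpl; lra|split; [|simpl; lra]].
    simpl; fold b; apply Rabs_lt_between; destruct hu; subst u; lra. }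
assert (h1 := hedge 1 ltac:(now left)); assert (h2 := hedge (-1) ltac:(now right)).
exists (Rmax (Rabs (d + 1 * b)) (Rabs (d + -1 * b))); split; [split|].
- eapply Rle_trans; [apply Rabs_pos|apply Rmax_l].
- apply Rmax_lub_lt; assumption.
- intros z hz; apply hT in hz; destruct hz as (hz & ha & _); split; [exact hz|].
  fold b in ha; apply Rabs_lt_between in ha.
  assert (h3 := Rmax_l (Rabs (d + 1 * b)) (Rabs (d + -1 * b))).
  assert (h4 := Rmax_r (Rabs (d + 1 * b)) (Rabs (d + -1 * b))).
  assert (h5 := Rle_abs (d + 1 * b)).
  assert (h6 := Rle_abs (- (d + -1 * b))); rewrite Rabs_Ropp in h6.
  apply Rabs_le_between; lra.
Qed.

(** * Weight sequences *)

Lemma eventually_bounded_below (u : nat -> R) (N : nat) (k : R) :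
  (forall n, (N <= n)%nat -> k <= u n) -> exists k', forall n, k' <= u n.
Proof.
revert k; induction N as [|N IH]; intros k h.
- exists k; intros n; apply h; lia.
- apply (IH (Rmin k (u N))); intros n hn.
  destruct (Nat.eq_dec n N) as [->|hne]; [apply Rmin_r|].
  eapply Rle_trans; [apply Rmin_l|apply h; lia].
Qed.

(** Logarithm of the fact that the exponential series at [exp y] dominates its term of index [p]. *)
Lemma pow_le_fact_exp (y : R) (p : nat) :
  INR p * y - ln (INR (Factorial.fact p)) <= exp y.
Proof.
assert (hf : 0 < INR (Factorial.fact p)) by (apply lt_0_INR, Factorial.lt_O_fact).
assert (hy := exp_pos y).
assert (h := exp_ge_taylor (exp y) p (Rlt_le _ _ hy)).
assert (hp : exp (INR p * y - ln (INR (Factorial.fact p))) = exp y ^ p / INR (Factorial.fact p)).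
{ unfold Rminus; rewrite exp_plus, exp_Ropp, exp_ln by exact hf.
  unfold Rdiv; f_equal; rewrite <- Rpower_pow by exact hy.
  unfold Rpower; rewrite ln_exp; reflexivity. }
apply Rnot_lt_le; intros hlt; apply exp_increasing in hlt.
rewrite hp in hlt; apply (Rlt_not_le _ _ hlt).
eapply Rle_trans; [|exact h].
destruct p as [|p]; [simpl; lra|].
rewrite tech5.
assert (0 <= sum_f_R0 (fun k => exp y ^ k / INR (Factorial.fact k)) p); [|lra].
apply cond_pos_sum; intros k; apply Rdiv_le_0_compat;
  [apply pow_le; lra|apply lt_0_INR, Factorial.lt_O_fact].
Qed.

Section Weight.

Variable M : nat -> R.
Hypothesis hM : weight_sequence M.

(** Eventually [m_n >= n ^ s]. The finitely many other indices are absorbed into [k], and the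
    product of the quotients gives [M p >= exp (k * p) * (p!) ^ s]. *)
Lemma ln_weight_ge (s : R) : 0 < s -> Rbar_lt s (omega M) ->
  exists k, forall p, INR p * k + s * ln (INR (Factorial.fact p)) <= ln (M p).
Proof.
intros hs hlt.
assert (hev : exists N, forall n, (N <= n)%nat ->
  s < ln (quotient M n) / ln (INR n)).
{ unfold omega in hlt.
  destruct (ex_LimInf_seq (fun p => ln (quotient M p) / ln (INR p))) as [w h].
  rewrite (is_LimInf_seq_unique _ _ h) in hlt.
  destruct w as [w| |]; simpl in hlt; [|apply h|contradiction].
  destruct (h (mkposreal _ (proj2 (Rlt_0_minus _ _) hlt))) as [_ [N hN]].
  exists N; intros n hn; specialize (hN n hn); simpl in hN; lra. }
destruct hev as [N hN].
(* From index [2] on, [ln (INR n)] is positive, so the quotient of logarithms can be cleared;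
   [- (s * ln 2)] comes from [n + 1 <= 2 * n]. *)
destruct (eventually_bounded_below
  (fun p => ln (quotient M p) - s * ln (INR (S p))) (Nat.max N 2) (- (s * ln 2)))
  as [k hk].
{ intros n hn; specialize (hN n ltac:(lia)).
  assert (hn2 : 2 <= INR n) by (replace 2 with (INR 2) by (simpl; lra); apply le_INR; lia).
  assert (hln : 0 < ln (INR n)) by (rewrite <- ln_1; apply ln_increasing; lra).
  apply Rlt_div_r in hN; [|exact hln].
  assert (h : ln (INR (S n)) <= ln 2 + ln (INR n)).
  { rewrite <- ln_mult by lra; apply ln_le; rewrite S_INR; lra. }
  assert (s * ln (INR (S n)) <= s * (ln 2 + ln (INR n))) by (apply Rmult_le_compat_l; lra).
  lra. }
exists k; induction p as [|p IH].
- rewrite (ws_zero M hM); simpl; rewrite ln_1; lra.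
- specialize (hk p); unfold quotient in hk.
  assert (hp := ws_pos M hM p); assert (hp' := ws_pos M hM (S p)).
  rewrite ln_div in hk by assumption.
  change (Factorial.fact (S p)) with (S p * Factorial.fact p)%nat.
  rewrite mult_INR, ln_mult
    by (apply lt_0_INR; first [lia|apply Factorial.lt_O_fact]).
  rewrite (S_INR p) at 1; lra.
Qed.

(** Here [x = ln t]. With [s = / mu] in [ln_weight_ge], the left side is at most [/ mu] times the
    left side of [pow_le_fact_exp] at [y = - mu * (k + x)]. Having [K >= 1] will make the
    coefficients [a n] summable. *)
Lemma weight_exponential_bound (mu : R) : 0 < mu -> Rbar_lt (/ mu) (omega M) ->
  exists K, 1 <= K /\ forall p x, - ln (M p) - INR p * x <= K * exp (- mu * x).
Proof.
intros hmu hlt.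
destruct (ln_weight_ge (/ mu) (Rinv_0_lt_compat _ hmu) hlt) as [k hk].
exists (Rmax 1 (/ mu * exp (- mu * k))); split; [apply Rmax_l|intros p x].
apply Rle_trans with (/ mu * exp (- mu * k) * exp (- mu * x));
  [|apply Rmult_le_compat_r; [apply Rlt_le, exp_pos|apply Rmax_r]].
specialize (hk p).
assert (h := pow_le_fact_exp (- mu * (k + x)) p).
apply (Rmult_le_compat_l (/ mu)) in h; [|apply Rlt_le, Rinv_0_lt_compat, hmu].
rewrite Rmult_assoc, <- exp_plus, <- Rmult_plus_distr_l.
replace (/ mu * (INR p * (- mu * (k + x)) - ln (INR (Factorial.fact p))))
  with (- (INR p * (k + x)) - / mu * ln (INR (Factorial.fact p))) in h by (field; lra).
lra.
Qed.

(** Let [X] be the left side. Multiplying its bound for [mu = rho + e n] by [a n * exp (e n * x)]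
    gives [X * (a n * exp (e n * x)) <= 2 ^ (- n - 1) * exp (- rho * x)]; summation over [n]
    concludes. *)
Lemma dirichlet_weight_bound (rho : R) (e : nat -> R) : 0 < rho ->
  Rbar_le (/ rho) (omega M) -> (forall n, 0 < e n <= 1) ->
  exists a : nat -> R, (forall n, 0 < a n) /\ ex_series a /\
    forall p x, - ln (M p) - INR p * x <= exp (- rho * x) / dirichlet_re a e x.
Proof.
intros hrho hle he.
assert (hK : forall n, exists K, 1 <= K /\ forall p x,
  - ln (M p) - INR p * x <= K * exp (- (rho + e n) * x)).
{ intros n; specialize (he n); apply weight_exponential_bound; [lra|].
  eapply Rbar_lt_le_trans; [|exact hle]; simpl.
  apply Rinv_lt_contravar; [apply Rmult_lt_0_compat|]; lra. }
set (K := fun n => proj1_sig (constructive_indefinite_description _ (hK n))).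
assert (hK1 : forall n, 1 <= K n)
  by (intros n; apply (proj2_sig (constructive_indefinite_description _ (hK n)))).
assert (hK2 : forall n p x, - ln (M p) - INR p * x <= K n * exp (- (rho + e n) * x))
  by (intros n; apply (proj2_sig (constructive_indefinite_description _ (hK n)))).
assert (hg : Rabs (/ 2) < 1) by (rewrite Rabs_pos_eq; lra).
assert (hexg : ex_series (fun n => / 2 * (/ 2) ^ n))
  by exact (ex_series_scal_l (K := R_AbsRing) (/ 2) _ (ex_series_geom _ hg)).
assert (hg1 : Series (fun n => / 2 * (/ 2) ^ n) = 1)
  by (rewrite Series_scal_l, Series_geom by exact hg; field).
assert (hgp : forall n, 0 < / 2 * (/ 2) ^ n)
  by (intros n; apply Rmult_lt_0_compat; [lra|apply pow_lt; lra]).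
set (a := fun n => / 2 * (/ 2) ^ n / K n).
assert (ha : forall n, 0 < a n)
  by (intros n; specialize (hK1 n); apply Rdiv_lt_0_compat; [apply hgp|lra]).
assert (hsum : ex_series a).
{ apply (ex_series_dominated _ _) with (2 := hexg); intros n.
  rewrite Rabs_pos_eq by apply Rlt_le, ha.
  specialize (hK1 n); specialize (hgp n); unfold a; apply Rle_div_l; [lra|].
  rewrite <- (Rmult_1_r (_ * _)) at 1; apply Rmult_le_compat_l; lra. }
exists a; split; [exact ha|split; [exact hsum|intros p x]].
assert (he' : forall n, 0 <= e n <= 1) by (intros n; specialize (he n); lra).
assert (hD := dirichlet_re_pos a e ha hsum he' x 0).
set (X := - ln (M p) - INR p * x).
assert (hE := exp_pos (- rho * x)).
(* For [X <= 0] the positive right side suffices; [X > 0] makes the compared terms nonnegative. *)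
destruct (Rle_or_lt X 0) as [hX|hX].
{ apply Rle_trans with (1 := hX), Rlt_le, Rdiv_lt_0_compat; lra. }
apply (Rle_div_r _ _ (dirichlet_re a e x)); [lra|].
unfold dirichlet_re; rewrite <- Series_scal_l.
(* The right side is expanded by [1 = sum_n 2 ^ (- n - 1)] for a termwise comparison. *)
rewrite <- (Rmult_1_r (exp _)), <- hg1, <- Series_scal_l.
apply Series_le; [|exact (ex_series_scal_l (K := R_AbsRing) _ _ hexg)].
intros n; specialize (hK2 n p x); fold X in hK2; specialize (hK1 n); specialize (hgp n).
assert (hx := exp_pos (e n * x)); specialize (ha n).
assert (hax : 0 <= a n * exp (e n * x)) by (apply Rmult_le_pos; lra).
split; [apply Rmult_le_pos; lra|].
apply (Rmult_le_compat_r (a n * exp (e n * x))) in hK2; [|exact hax].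
eapply Rle_trans; [exact hK2|right].
replace (- rho * x) with (- (rho + e n) * x + e n * x) by ring.
rewrite exp_plus; unfold a; field; lra.
Qed.

End Weight.

Lemma exp_le_exp (x y : R) : x <= y -> exp x <= exp y.
Proof. intros [h| ->]; [apply Rlt_le, exp_increasing, h|lra]. Qed.

Lemma partial_sum_zero (p : nat) (w : C) : partial_sum (fun _ => RtoC 0) p w = RtoC 0.
Proof.
induction p as [|p IH]; [reflexivity|rewrite partial_sum_S, IH; ring].
Qed.

(** * The flat function *)

(* The quotient
   [exp (- rho * x) / dirichlet_re a e x] bounds [- ln (M p * exp (p * x))] and
   gains the factor [exp (- rho * tau)] when [x] is replaced by [x + tau]; this absorbs
   the factor lost near the sides of the sector into the constant [AT]. *)
Lemma flat_function_exists (M : nat -> R) (w : R) : weight_sequence M -> 0 < w ->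
  omega M = Finite w ->
  exists f : surface -> C, holomorphic_on (sector w) f /\
    asymptotic_expansion M w f (fun _ => RtoC 0) /\ forall z, f z <> RtoC 0.
Proof.
intros hM hw hom.
(* All exponents [e n = / (INR n + B)] are at most [/ B], and [B] exceeds the half-opening
   [w * PI / 2]; hence [e n * |arg z| <= 1] on the whole sector. *)
set (B := PI * w + 1); assert (hpi := PI_RGT_0).
assert (hB : 1 < B) by (unfold B; assert (h := Rmult_lt_0_compat _ _ hpi hw); lra).
set (e := fun n => / (INR n + B)).
assert (heB : forall n, 0 < e n <= / B).
{ intros n; assert (hn := pos_INR n); split; [apply Rinv_0_lt_compat; lra|].
  apply Rinv_le_contravar; lra. }
assert (hB1 : / B <= 1) by (rewrite <- Rinv_1; apply Rinv_le_contravar; lra).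
assert (he : forall n, 0 <= e n <= 1) by (intros n; specialize (heB n); lra).
assert (he_decr : forall n, e (S n) < e n).
{ intros n; assert (hn := pos_INR n); unfold e; rewrite S_INR.
  apply Rinv_lt_contravar; [apply Rmult_lt_0_compat|]; lra. }
assert (he_lim : is_lim_seq e 0).
{ apply (is_lim_seq_inv _ p_infty); [|easy].
  apply (is_lim_seq_plus _ _ p_infty B); [apply is_lim_seq_INR|apply is_lim_seq_const|easy]. }
assert (harg : forall t, 0 <= t <= w * PI / 2 -> forall n, e n * t <= 1).
{ intros t ht n; specialize (heB n).
  apply Rle_trans with (/ B * B); [|right; field; lra].
  apply Rmult_le_compat; try lra; unfold B; lra. }
set (rho := / w).
assert (hrho : 0 < rho) by (apply Rinv_0_lt_compat, hw).
destruct (dirichlet_weight_bound M hM rho e) as (a & ha & hsum & hX).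
{ exact hrho. }
{ rewrite hom; unfold rho; simpl; rewrite Rinv_inv; lra. }
{ intros n; specialize (heB n); lra. }
exists (fun z => cexp (- 1 * flat_exponent a e rho (log_coord z))%C).
split; [|split; [|intros z; apply cexp_neq_0]].
- apply (holomorphic_on_log_coord _ (fun s => cexp (- 1 * flat_exponent a e rho s)%C)).
  intros z [hz hzarg]; split; [exact hz|].
  destruct (quad_diff_flat_exponent a e ha hsum he rho (log_coord z)) as [l hl].
  { intros n; rewrite Rabs_mult, Rabs_pos_eq by apply he.
    apply harg; split; [apply Rabs_pos|apply Rlt_le, hzarg]. }
  eexists; apply (quad_diff_comp (fun s => - 1 * flat_exponent a e rho s)%C cexp).
  + apply (quad_diff_comp (flat_exponent a e rho) (fun s => - 1 * s)%C);
      [exact hl|apply quad_diff_lin].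
  + apply quad_diff_cexp.
- intros T hT.
  destruct (proper_subsector_arg_bound T w hT) as (beta & hbeta & hTb).
  destruct (re_flat_exponent_ge_near a e ha hsum he he_decr he_lim rho beta)
    as (kappa & x0 & hkappa & hnear); [lra|exact hrho| |apply harg; lra|].
  (* The opening is critical: [rho * (w * PI / 2) = PI / 2]. Strictness comes only from
     [beta < w * PI / 2], that is, from [T] being a proper subsector. *)
  { apply Rlt_le_trans with (rho * (w * PI / 2)); [apply Rmult_lt_compat_l; lra|].
    unfold rho; right; field; lra. }
  set (g := fun x => exp (- rho * x) / dirichlet_re a e x).
  assert (hDp : forall x, 0 < dirichlet_re a e x)
    by (intros x; assert (h := dirichlet_re_pos a e ha hsum he x 0); lra).
  assert (hgp : forall x, 0 < g x)
    by (intros x; apply Rdiv_lt_0_compat; [apply exp_pos|apply hDp]).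
  assert (hg : forall x t, 0 <= t -> g (x + t) <= exp (- rho * t) * g x).
  { intros x t ht; unfold g, Rdiv.
    rewrite Rmult_plus_distr_l, exp_plus, (Rmult_comm (exp (- rho * x))), Rmult_assoc.
    apply Rmult_le_compat_l; [apply Rlt_le, exp_pos|].
    apply Rmult_le_compat_l; [apply Rlt_le, exp_pos|].
    apply Rinv_le_contravar; [apply hDp|].
    apply dirichlet_re_le_mono; try assumption; lra. }
  (* Chosen so that [exp (- rho * tau) = kappa], whence [g (x + tau) <= kappa * g x]; [kappa <= 1]
     makes [tau] nonnegative. *)
  set (tau := - ln kappa * w).
  assert (htau : 0 <= tau).
  { apply Rmult_le_pos; [|lra].
    assert (h := ln_le kappa 1 (proj1 hkappa) (proj2 hkappa)); rewrite ln_1 in h; lra. }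
  assert (hrt : exp (- rho * tau) = kappa).
  { rewrite <- (exp_ln kappa) at 1 by lra; f_equal; unfold rho, tau; field; lra. }
  (* For [x > x0], [g (x + tau)] costs at most [g x0] and the crude lower bound on the real part at
     most [8 * g x0]. *)
  exists (exp (9 * g x0)), (exp tau).
  split; [apply exp_pos|split; [apply exp_pos|intros z hz p]].
  destruct (hTb z hz) as [hzs hza].
  rewrite partial_sum_zero.
  replace (cexp (- 1 * flat_exponent a e rho (log_coord z)) - 0)%C
    with (cexp (- 1 * flat_exponent a e rho (log_coord z))) by ring.
  rewrite Cmod_cexp.
  set (s := log_coord z).
  replace (Re (- 1 * flat_exponent a e rho s)%C) with (- Re (flat_exponent a e rho s))
    by (unfold Re; simpl; ring).
  change (arg z) with (Im s) in hza.
  set (x := Re s).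
  assert (hmod : modulus z = exp x) by (symmetry; apply exp_ln, hzs).
  assert (hpow : forall y, exp y ^ p = exp (INR p * y)).
  { intros y; rewrite <- Rpower_pow by apply exp_pos; unfold Rpower; now rewrite ln_exp. }
  rewrite hmod, !hpow, <- (exp_ln (M p)) by apply (ws_pos M hM).
  rewrite <- !exp_plus; apply exp_le_exp.
  (* The shifted point appears because [AT ^ p * modulus z ^ p = exp (INR p * (x + tau))]. *)
  specialize (hX p (x + tau)); fold (g (x + tau)) in hX.
  assert (hgt := hg x tau htau); rewrite hrt in hgt.
  enough (g (x + tau) <= Re (flat_exponent a e rho s) + 9 * g x0) by lra.
  assert (hg0 := hgp x0).
  destruct (Rle_or_lt x x0) as [hx|hx].
  + specialize (hnear s hza hx); fold x (g x) in hnear; lra.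
  + assert (hall := re_flat_exponent_ge_all a e ha hsum he rho s).
    fold x (g x) in hall.
    assert (hmono : g x <= g x0).
    { replace x with (x0 + (x - x0)) by ring.
      eapply Rle_trans; [apply hg; lra|].
      rewrite <- (Rmult_1_l (g x0)) at 2; apply Rmult_le_compat_r; [lra|].
      rewrite <- exp_0; apply exp_le_exp.
      assert (h := Rmult_lt_0_compat _ _ hrho (proj2 (Rlt_0_minus _ _) hx)); lra. }
    assert (kappa * g x <= 1 * g x) by (apply Rmult_le_compat_r; [apply Rlt_le, hgp|lra]).
    assert (hall' : - (8 * g x) <= Re (flat_exponent a e rho s)).
    { apply hall; intros n; rewrite Rabs_mult, Rabs_pos_eq by apply he.
      apply Rle_trans with (2 := harg beta ltac:(lra) n).
      apply Rmult_le_compat_l; [apply he|exact hza]. }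
    lra.
Qed.

Lemma class_A_zero (M : nat -> R) (gamma : R) : weight_sequence M ->
  holomorphic_on (sector gamma) (fun _ => RtoC 0) /\
  asymptotic_expansion M gamma (fun _ => RtoC 0) (fun _ => RtoC 0).
Proof.
intros hM; split.
- intros z0 _; exists (RtoC 0).
  apply (filterlim_ext (fun _ => RtoC 0)); [|apply filterlim_const].
  intros z; unfold Cdiv; ring.
- intros T hT; destruct (proper_subsector_arg_bound T gamma hT) as (beta & _ & hTb).
  exists 1, 1; split; [lra|split; [lra|intros z hz p]].
  rewrite partial_sum_zero; replace (RtoC 0 - RtoC 0)%C with (RtoC 0) by ring.
  rewrite Cmod_0, pow1; assert (h1 := ws_pos M hM p).
  destruct (hTb z hz) as [hzs _]; assert (h2 := pow_lt _ p hzs).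
  assert (h3 := Rmult_lt_0_compat _ _ h1 h2); lra.
Qed.

Theorem theorem3p15 (M : nat -> R) (hM : weight_sequence M)
    (hpos : Rbar_lt (Finite 0) (omega M)) (hfin : Rbar_lt (omega M) p_infty) :
  ~ I_tilde M (real (omega M)).
Proof.
destruct (omega M) as [w| |] eqn:hom; try contradiction; simpl in hpos |- *.
intros [_ hinj].
destruct (flat_function_exists M w hM hpos hom) as (f & hf & hflat & hne).
destruct (class_A_zero M w hM) as [h0 hflat0].
(* Injectivity would identify the flat function with zero at the point of modulus [1] and argument
   [0], where it does not vanish. *)
apply (hne (1, 0)), (hinj f (fun _ => RtoC 0)).
- split; [exact hf|eexists; exact hflat].
- split; [exact h0|eexists; exact hflat0].
- rewrite (borel_map_eq M w f _ hpos hflat), (borel_map_eq M w _ _ hpos hflat0); reflexivity.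
- assert (h := Rmult_lt_0_compat _ _ hpos PI_RGT_0).
  unfold sector, on_surface, modulus, arg; cbn [fst snd]; rewrite Rabs_R0; lra.
Qed.
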